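(* Let $h>0$ be fixed, let $\alpha=(a(h),\{u(t):0\le t\le h\})$ be a DDE initial condition, and let $(a_\alpha(t),b_\alpha(t))_{t\ge h}$ be the associated solution of the fluid equations. For every $T\ge 2h$ there is a constant $C<\infty$ (depending on $T,\alpha$), and for every $\delta>0$ there is $\lambda_0<\infty$ (depending on $T,\delta,\alpha$), such that the following holds for all $\lambda\ge\lambda_0$ with $\lambda h$ a positive integer. For every $v\in F(\alpha,\lambda)$, if $(A_v^{(\lambda)}(t),B_v^{(\lambda)}(t))_{t\ge h}$ is the rescaled tangle process with initial conditions $(\xi_\alpha,v)$, then $$\mathbb{P}\left(\sup_{2h\le t\le T}|B_v^{(\lambda)}(t)-b_\alpha(t)|>\delta\right)\le \mathbb{P}\left(\sup_{h\le t\le T}|A_v^{(\lambda)}(t)-a_\alpha(t)|>\delta\right)\le C\,\lambda^{-1}\,\delta^{-2}.$$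
   Context: Throughout, $h>0$ is a fixed real number, $\lambda>0$ is such that $m=\lambda h$ is a positive integer, and $t_n=\lambda^{-1}n$. **DDE initial condition.** A pair $\alpha=(a(h),\{u(t):0\le t\le h\})$ with $a(h)>0$ a real number and $u$ an integrable function on $[0,h]$ with $0\le u(t)\le 2$ for all $t\in[0,h]$. **Solution of the fluid equations associated with $\alpha$.** The unique pair of continuous functions $(a_\alpha(t),b_\alpha(t))=(a(t),b(t))$ on $[h,\infty)$ such that for $h\le t\le 2h$ $$b(t)=a(h)+t-h+\int_{t-h}^h u(s)\,ds,\qquad a(t)=P(h,t)^{-1}a(h)+P(h,t)^{-1}\int_h^t P(h,s)\,ds,$$ where $P(x,y)=\exp\left(2\int_x^y b(s)^{-1}ds\right)$, and for all $t>2h$ $$\frac{da}{dt}=1-2\frac{a(t)}{b(t)},\qquad \frac{db}{dt}=1-2\frac{a(t-h)}{b(t-h)}.$$ **Tangle process (random tip growth model).** Initial conditions are $(\xi,v)$ with $\xi\ge 1$ an integer and $v=(v_1,\dots,v_m)\in\mathcal{S}(m)=\{0,1,2\}^m$. Set $U_i=v_i$ for $i=1,\dots,m$, $X_m=\xi$, and for all $n\ge m$ $$W_n=\sum_{j=n-m+1}^n U_j,\qquad X_{n+1}=X_n+1-U_{n+1},\qquad L_n=W_n+X_n.$$ With $\mathcal{F}(\lambda,n)=\sigma(U_1,\dots,U_n)$, for each $n\ge m$ the random variable $U_{n+1}\in\{0,1,2\}$ has conditional distribution $$\mathbb{P}(U_{n+1}=2\mid\mathcal{F}(\lambda,n))=\frac{X_n(X_n-1)}{L_n^2},\quad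 \mathbb{P}(U_{n+1}=0\mid\mathcal{F}(\lambda,n))=\frac{W_n^2}{L_n^2},\quad \mathbb{P}(U_{n+1}=1\mid\mathcal{F}(\lambda,n))=\frac{2W_nX_n+X_n}{L_n^2}.$$ These rules determine the law of $(X_n,L_n)_{n\ge m}$ (one always has $X_n\ge 1$). In particular $L_{m+j}=\xi+j+\sum_{i=j+1}^m v_i$ for $j=0,\dots,m$. **Rescaled process.** For $t\ge h$, $A_v^{(\lambda)}(t)=\lambda^{-1}X_{n(t)}$ and $B_v^{(\lambda)}(t)=\lambda^{-1}L_{n(t)}$, where $n(t)=\lfloor\lambda t\rfloor$. **Initial data derived from $\alpha$.** $\xi_\alpha=\max(\lfloor\lambda a(h)\rfloor,1)$, and $$F(\alpha,\lambda)=\left\{v\in\mathcal{S}(m):\ \sup_{m\le n\le 2m}|B_v^{(\lambda)}(t_n)-b_\alpha(t_n)|\le 4h^{1/2}\lambda^{-1/2}+\lambda^{-1}\right\},$$ where $B_v^{(\lambda)}$ is computed from the initial conditions $(\xi_\alpha,v)$ (so $B_v^{(\lambda)}(t_{m+j})=\lambda^{-1}(\xi_\alpha+j+\sum_{i=j+1}^m v_i)$ for $0\le j\le m$). *)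

(* Defs.v *)
From HB Require Import structures.
From mathcomp Require Import all_boot all_order all_algebra.
From mathcomp Require Import all_classical all_reals all_analysis.
Import Order.TTheory GRing.Theory Num.Theory.
Import numFieldNormedType.Exports.

Set Implicit Arguments.
Unset Strict Implicit.
Unset Printing Implicit Defensive.

Local Open Scope classical_set_scope.
Local Open Scope ring_scope.

(* Developed in MathComp and MathComp-Analysis, over an arbitrary realType. *)

(* The supremum is taken in the extended reals, so it carries no default
   value. *)
Definition sup_dist (R : realType) (D : set R) (f g : R -> R) : \bar R :=
  ereal_sup [set `|f t - g t|%:E | t in D].

Definition dde_init (R : realType) (h a0 : R) (u : R -> R) : Prop :=
  [/\ 0 < a0,
      (@lebesgue_measure R).-integrable `[0, h] (EFin \o u) &
      forall t, 0 <= t <= h -> 0 <= u t <= 2].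

Definition fluid_P (R : realType) (b : R -> R) (x y : R) : R :=
  expR (2 * \int[@lebesgue_measure R]_(s in `[x, y]) (b s)^-1).

(* Only the values of a and b on [h, +oo[ are constrained. *)
Definition fluid_solution (R : realType) (h a0 : R) (u a b : R -> R) : Prop :=
  [/\ {within `[h, +oo[, continuous a} /\ {within `[h, +oo[, continuous b},
      (forall t, h <= t <= 2 * h ->
         b t = a0 + t - h + \int[@lebesgue_measure R]_(s in `[t - h, h]) u s),
      (forall t, h <= t <= 2 * h ->
         a t = (fluid_P b h t)^-1 * a0
               + (fluid_P b h t)^-1
                 * \int[@lebesgue_measure R]_(s in `[h, t]) fluid_P b h s) &
      (forall t, 2 * h < t ->
         is_derive t 1 a (1 - 2 * (a t / b t)) /\
         is_derive t 1 b (1 - 2 * (a (t - h) / b (t - h))))].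

(* A path is U_1, U_2, ...; the entry at index 0 is never used. X, W and L are
   meaningful for n >= m only, with X frozen at xi below m. X is an integer:
   it is at least 1 almost surely, but not along every path. *)
Fixpoint tangleX (m xi : nat) (U : nat -> nat) (n : nat) : int :=
  if n is n'.+1 then
    if (n' < m)%N then xi%:Z else tangleX m xi U n' + 1 - (U n'.+1)%:Z
  else xi%:Z.

Definition tangleW (m : nat) (U : nat -> nat) (n : nat) : nat :=
  (\sum_((n - m).+1 <= j < n.+1) U j)%N.

Definition tangleL (m xi : nat) (U : nat -> nat) (n : nat) : int :=
  (tangleW m U n)%:Z + tangleX m xi U n.

Definition tangle_prob (R : realType) (m xi : nat) (U : nat -> nat)
    (n k : nat) : R :=
  let x := (tangleX m xi U n)%:~R in
  let w := (tangleW m U n)%:R in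
  let l := (tangleL m xi U n)%:~R in
  match k with
  | 0 => w ^+ 2 / l ^+ 2
  | 1 => (2 * w * x + x) / l ^+ 2
  | 2 => x * (x - 1) / l ^+ 2
  | _ => 0
  end.

(* Y is a version of the conditional probability of the event E given the
   sub-sigma-algebra G. *)
Definition is_cond_prob d (T : measurableType d) (R : realType)
    (P : probability T R) (G : set (set T)) (E : set T) (Y : T -> R) : Prop :=
  [/\ (forall B, measurable B -> G (Y @^-1` B)),
      P.-integrable setT (EFin \o Y) &
      forall A, G A -> (\int[P]_(w in A) (Y w)%:E = P (E `&` A))%E].

(* sigma(U_1, ..., U_n) *)
Definition history d (T : measurableType d) (U : nat -> T -> nat) (n : nat) :
    set (set T) :=
  g_sigma_preimage (fun i : 'I_n => U i.+1).

(* v_1, ..., v_m are the components of index 0, ..., m.-1 of the tuple v. *)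
Definition tangle_process d (T : measurableType d) (R : realType)
    (P : probability T R) (m xi : nat) (v : m.-tuple 'I_3)
    (U : nat -> T -> nat) : Prop :=
  [/\ (forall n, measurable_fun setT (U n)),
      (forall n w, (0 < n)%N -> (U n w <= 2)%N),
      (forall (i : 'I_m) w, U i.+1 w = tnth v i) &
      (forall n k, (m <= n)%N -> (k <= 2)%N ->
         is_cond_prob P (history U n) (U n.+1 @^-1` [set k])
           (fun w => tangle_prob R m xi (U ^~ w) n k))].

(* Num.truncn is the natural number floor on nonnegative reals. *)
Definition rescaledA (R : realType) (lambda : R) (m xi : nat) (U : nat -> nat)
    (t : R) : R :=
  lambda^-1 * (tangleX m xi U (Num.truncn (lambda * t)))%:~R.

Definition rescaledB (R : realType) (lambda : R) (m xi : nat) (U : nat -> nat)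
    (t : R) : R :=
  lambda^-1 * (tangleL m xi U (Num.truncn (lambda * t)))%:~R.

Definition xi_init (R : realType) (lambda a0 : R) : nat :=
  maxn (Num.truncn (lambda * a0)) 1.

(* The value of L_{m+j} for j <= m, which depends on the initial conditions
   only; see tangleL_init. *)
Definition initL (m xi : nat) (v : m.-tuple 'I_3) (j : nat) : nat :=
  (xi + j + \sum_(i < m | j <= i) tnth v i)%N.

(* The sup over m <= n <= 2m, with n = m + j. *)
Definition F_init (R : realType) (h a0 : R) (b : R -> R) (lambda : R)
    (m : nat) (v : m.-tuple 'I_3) : Prop :=
  \big[Num.max/0]_(j < m.+1)
     `|lambda^-1 * (initL (xi_init lambda a0) v j)%:R
       - b (lambda^-1 * (m + j)%:R)|
  <= 4 * Num.sqrt h * (Num.sqrt lambda)^-1 + lambda^-1.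

Lemma tangleX_init (m xi : nat) (U : nat -> nat) :
  tangleX m xi U m = xi%:Z.
Proof. by case: m => [|m] //=; rewrite ltnSn. Qed.

Lemma tangleL_init (m xi : nat) (v : m.-tuple 'I_3) (U : nat -> nat) (j : nat) :
  (forall i : 'I_m, U i.+1 = tnth v i) -> (j <= m)%N ->
  tangleL m xi U (m + j) = (initL xi v j)%:Z.
Proof.
move=> Uv jm.
have XE k : tangleX m xi U (m + k) =
    (xi + k)%N%:Z - (\sum_(m.+1 <= i < (m + k).+1) U i)%N%:Z.
  elim: k => [|k IH]; first by rewrite !addn0 tangleX_init big_geq// subr0.
  rewrite addnS /= ltnNge leq_addr /= IH.
  rewrite [in RHS]big_nat_recr /=; last by rewrite ltnS leq_addr.
  rewrite addnS -[(xi + k).+1]addn1 !PoszD opprD !addrA.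
  by congr (_ - _); rewrite addrAC.
rewrite /tangleL XE /tangleW addnC addnK /initL.
rewrite (big_cat_nat (n := m.+1)) /= ?ltnS ?leq_addl// 1?addnC//.
rewrite !PoszD addrC addrA subrK; congr (_ + _).
rewrite big_add1 /= (big_nat_widenl _ 0)//= big_mkord.
by congr Posz; apply: eq_bigr => i _; rewrite Uv.
Qed.

(* Main.v *)
Require Import Defs.
From HB Require Import structures.
From mathcomp Require Import all_boot all_order all_algebra.
From mathcomp Require Import all_classical all_reals all_analysis.
From mathcomp Require Import ring lra zify.
Import Order.TTheory GRing.Theory Num.Theory.
Import numFieldNormedType.Exports.

Set Implicit Arguments.
Unset Strict Implicit.
Unset Printing Implicit Defensive.

(** Write [X_(n+1) = X_n + 1 - drift_n - (U_(n+1) - drift_n)], where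
[drift_n = 2 X_n / L_n - X_n / L_n ^ 2] is the conditional mean of [U_(n+1)].
After division by [lambda] this is an Euler scheme of step [1 / lambda] for
[a' = 1 - 2 a / b], perturbed by the term [X / L ^ 2], of order [1 / lambda],
and by a martingale, [noise].

Both systems carry their second component as a delayed copy of the first:
[L_(n+m) = X_n + m] ([tangleL_delay]) and [b (t + h) = a t + h]
([fluid_b_delay]). Hence the error of [B] at time [t] is the error of [A] at
time [t - h], which makes the first inequality an inclusion of events; and in
the Euler scheme the error of [B] is an earlier error of [A], except on
[[h, 2h]] where it is bounded by the choice of [v].

The increments of the noise have conditional second moment at most 4, so the
maximal inequality [prob_deviates_le] shows that the noise stays below a level
[c] up to step [N] outside an event of probability at most
[4 (N - m) / c ^ 2]. Off this event [a / b] is compared with [A / B]: since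
[0 <= A / B <= 1], the difference is Lipschitz in the two errors as soon as [b]
is bounded below by some [beta > 0] on [[h, T]] ([fluid_b_lower]). The discrete
Gronwall inequality [delayed_gronwall] then bounds the error of [A] by
[M = exp (4 T / beta)] times the sum of the noise level divided by [lambda] and
of errors which tend to 0 as [lambda] grows ([good_close]). As [M] does not
depend on [delta], the noise level [c = delta * lambda / (4 M)] is admissible,
and [N <= lambda * T] gives the bound with [C = 64 * T * M ^ 2]; all the other
errors are absorbed by [lambda0]. *)

Local Open Scope classical_set_scope.
Local Open Scope ring_scope.

(** * Paths of the tangle process *)

Definition agree (n : nat) (x y : nat -> nat) : Prop :=
  forall i, (0 < i <= n)%N -> x i = y i.

Lemma agree_le k n x y : (k <= n)%N -> agree n x y -> agree k x y.
Proof.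
by move=> kn xy i /andP[i0 ik]; apply: xy; rewrite i0 (leq_trans ik kn).
Qed.

Lemma agree_sym n x y : agree n x y -> agree n y x.
Proof. by move=> xy i /xy ->. Qed.

Lemma agree_tangleX m xi n x y :
  agree n x y -> tangleX m xi x n = tangleX m xi y n.
Proof.
elim: n => [//|n IH] xy /=; rewrite (IH (agree_le (leqnSn n) xy)).
by rewrite xy ?ltnSn.
Qed.

Lemma agree_tangleW m n x y :
  agree n x y -> tangleW m x n = tangleW m y n.
Proof.
move=> xy; rewrite /tangleW; apply: eq_big_nat => i /andP[mi].
by rewrite ltnS => i_n; apply: xy; rewrite i_n (leq_trans _ mi).
Qed.

Lemma agree_tangleL m xi n x y :
  agree n x y -> tangleL m xi x n = tangleL m xi y n.
Proof.
by move=> xy; rewrite /tangleL (agree_tangleX _ _ xy) (agree_tangleW _ xy).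
Qed.

Lemma tangleXS m xi x n : (m <= n)%N ->
  tangleX m xi x n.+1 = tangleX m xi x n + 1 - (x n.+1)%:Z.
Proof. by move=> mn /=; rewrite ltnNge mn. Qed.

(** Over the [m] steps after [n], [X] gains [m] and loses the sum of the [U],
    which is what [W] holds at the end of these steps. *)
Lemma tangleL_delay m xi x n : (m <= n)%N ->
  tangleL m xi x (n + m) = tangleX m xi x n + m%:Z.
Proof.
move=> mn.
have XE k : tangleX m xi x (n + k) + (\sum_(n.+1 <= j < (n + k).+1) x j)%N%:Z
    = tangleX m xi x n + k%:Z.
  elim: k => [|k IH]; first by rewrite !addn0 big_geq.
  rewrite addnS tangleXS ?(leq_trans mn) ?leq_addr//.
  rewrite big_nat_recr/= ?ltnS ?leq_addr//.
  by move: IH; lia.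
by rewrite /tangleL /tangleW addnK addrC XE.
Qed.

Section drift.
Context (R : realType) (m xi : nat).
Implicit Types (x y : nat -> nat) (n : nat).

(** The conditional mean of [U_(n+1)] given the first [n] steps; see
    [tangle_prob_moments]. *)
Definition drift x n : R :=
  2 * (tangleX m xi x n)%:~R / (tangleL m xi x n)%:~R
  - (tangleX m xi x n)%:~R / (tangleL m xi x n)%:~R ^+ 2.

Definition noise x n : R :=
  \sum_(m <= k < n) ((x k.+1)%:R - drift x k).

Lemma agree_drift n x y : agree n x y -> drift x n = drift y n.
Proof.
by move=> xy; rewrite /drift (agree_tangleX _ _ xy) (agree_tangleL _ _ xy).
Qed.

Lemma agree_noise n x y : agree n x y -> noise x n = noise y n.
Proof.
move=> xy; apply: eq_big_nat => k /andP[_ kn].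
by rewrite (agree_drift (agree_le (ltnW kn) xy)) xy// kn.
Qed.

Lemma noiseS x n : (m <= n)%N ->
  noise x n.+1 = noise x n + ((x n.+1)%:R - drift x n).
Proof. by move=> mn; rewrite /noise big_nat_recr. Qed.

Lemma noise_init x : noise x m = 0.
Proof. by rewrite /noise big_geq. Qed.

Lemma tangleX_noise x n : (m <= n)%N ->
  (tangleX m xi x n)%:~R
  = xi%:R + \sum_(m <= k < n) (1 - drift x k) - noise x n :> R.
Proof.
move=> /subnKC <-; elim: (n - m)%N => [|k IH].
  by rewrite addn0 tangleX_init noise_init big_geq// subr0 addr0.
rewrite addnS tangleXS ?leq_addr// noiseS ?leq_addr//.
by rewrite big_nat_recr ?leq_addr//= !rmorphD/= rmorphN/= IH; lra.
Qed.

Lemma tangleL_gt0 x n : (1 <= tangleX m xi x n)%R -> 0 < tangleL m xi x n.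
Proof. by rewrite /tangleL => X1; lia. Qed.

Lemma ratio_le1 x n : (1 <= tangleX m xi x n)%R ->
  0 <= ((tangleX m xi x n)%:~R / (tangleL m xi x n)%:~R : R) <= 1.
Proof.
move=> X1; have L0 := tangleL_gt0 X1.
rewrite divr_ge0 ?ler0z ?(ltW L0) ?(le_trans _ X1)//=.
rewrite ler_pdivrMr ?ltr0z// mul1r ler_int /tangleL; lia.
Qed.

(** The rates sum to 1 because their numerators add up to [(W + X) ^ 2]. Both
    [U] and its mean lie in [[0, 2]], whence the bound on the increment. *)
Lemma tangle_prob_moments x n : (1 <= tangleX m xi x n)%R ->
  let p := tangle_prob R m xi x n in
  [/\ forall k, 0 <= p k,
      p 0%N + p 1%N + p 2%N = 1,
      p 1%N + 2 * p 2%N = drift x n &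
      forall k, (k <= 2)%N -> `|k%:R - drift x n| <= 2].
Proof.
move=> X1 p; have L0 := tangleL_gt0 X1.
have := @ratio_le1 x n X1.
have LE : (tangleL m xi x n)%:~R
   = (tangleW m x n)%:R + (tangleX m xi x n)%:~R :> R.
  by rewrite /tangleL rmorphD.
have Xr : 1 <= (tangleX m xi x n)%:~R :> R by rewrite ler1z.
have Lr : 0 < (tangleL m xi x n)%:~R :> R by rewrite ltr0z.
have Wr : 0 <= (tangleW m x n)%:R :> R by [].
rewrite /p /tangle_prob /drift.
move: Xr Lr Wr LE; 
move: ((tangleX m xi x n)%:~R : R) ((tangleL m xi x n)%:~R : R).
move: ((tangleW m x n)%:R : R) => W X L X1' Lr W0 LE.
have L2 : 0 < L ^+ 2 by rewrite exprn_gt0.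
move=> q01.
have q2 : 0 <= X / L ^+ 2 <= X / L.
  have X0 : 0 < X by apply: lt_le_trans X1'.
  rewrite divr_ge0 ?(ltW L2) ?(ltW X0)//= ler_pM2l// lef_pV2 ?posrE//.
  by rewrite expr2 ler_peMl ?(ltW Lr)//; lra.
split.
- move=> [|[|[|k]]] //; apply: divr_ge0; rewrite ?(ltW L2)// ?sqr_ge0//; nra. 
- have -> : W = L - X by lra.
  by field; rewrite gt_eqF.
- have -> : W = L - X by lra.
  by field; rewrite gt_eqF.
- move=> k k2.
  have k01 : 0 <= (k%:R : R) <= 2 by rewrite ler0n/= ler_nat.
  by rewrite ler_norml -mulrA; lra.
Qed.

End drift.

(** * The maximal inequality *)

Definition set_coord (x : nat -> nat) (i k : nat) : nat -> nat :=
  fun j => if j == i then k else x j.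

Lemma set_coord_id x i j : set_coord x i (x i) j = x j.
Proof. by rewrite /set_coord; case: eqP => [->|]. Qed.

Lemma agree_set_coord n x k : agree n x (set_coord x n.+1 k).
Proof.
by move=> i /andP[_ i_n]; rewrite /set_coord ifN_eq// neq_ltn ltnS i_n.
Qed.

(** The coordinates are discrete, so fixing them one at a time writes the event
    as a countable union of cylinders. *)
Lemma sigma_algebra_finitary (T : Type) (G : set_system T)
    (U : nat -> T -> nat) (N : nat) (Q : (nat -> nat) -> Prop) :
    sigma_algebra setT G ->
    (forall i k, (0 < i <= N)%N -> G (U i @^-1` [set k])) ->
    (forall x y, agree N x y -> Q x -> Q y) ->
  G [set w | Q (U ^~ w)].
Proof.
move=> sG; have [GT _ _ GI] := (sigma_algebraP (fun X _ => @subsetT _ X)).1 sG.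
have [G0 _ GU] := sG.
elim: N Q => [|N IH] Q GUk QN.
  have [Q0|nQ0] := pselect (Q (fun=> 0%N)).
    suff -> : [set w | Q (U ^~ w)] = setT by [].
    by rewrite predeqE => w; split=> // _; apply: QN Q0 => -[].
  suff -> : [set w | Q (U ^~ w)] = set0 by [].
  by rewrite predeqE => w; split=> // Qw; apply: nQ0; apply: QN Qw => -[].
have -> : [set w | Q (U ^~ w)] =
    \bigcup_k (U N.+1 @^-1` [set k]
               `&` [set w | Q (set_coord (U ^~ w) N.+1 k)]).
  rewrite predeqE => w; split=> [Qw|[k _ [/= <- Qw]]].
    exists (U N.+1 w) => //; split=> //=.
    by apply: QN Qw => i _; rewrite set_coord_id.
  by apply: QN Qw => i _; rewrite (set_coord_id (U^~ w)).
apply: GU => k; apply: GI; first by apply: GUk; rewrite ltnSn.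
apply: (IH (fun x => Q (set_coord x N.+1 k))).
  by move=> i l /andP[i0 iN]; apply: GUk; rewrite i0 (leq_trans iN).
move=> x y xy; apply: QN => i /andP[i0]; rewrite /set_coord leq_eqVlt ltnS.
by case: eqP => //= _ iN; apply: xy; rewrite i0.
Qed.

Section cylinders.
Context d (T : measurableType d) (U : nat -> T -> nat).
Hypothesis mU : forall n, measurable_fun setT (U n).

Definition cylinder n x : set T := [set w | agree n x (U ^~ w)].

Lemma measurable_finitary N (Q : (nat -> nat) -> Prop) :
  (forall x y, agree N x y -> Q x -> Q y) -> measurable [set w | Q (U ^~ w)].
Proof.
apply: sigma_algebra_finitary; first exact: sigma_algebra_measurable.
by move=> i k _; rewrite -[X in measurable X]setTI; exact: mU.
Qed.

Lemma measurable_cylinder n x : measurable (cylinder n x).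
Proof.
apply: (@measurable_finitary n) => y z yz xy i i_n.
by rewrite xy// yz.
Qed.

Lemma history_cylinder n x : history U n (cylinder n x).
Proof.
apply: (@sigma_algebra_finitary _ _ _ n).
- exact: smallest_sigma_algebra.
- move=> [//|i] k i_n; apply: sub_sigma_algebra.
  by rewrite (bigD1 (Ordinal i_n))//=; left; exists [set k]; rewrite ?setTI.
- by move=> y z yz xy i i_n; rewrite xy// yz.
Qed.

Lemma cylinderS n x :
  cylinder n x = \bigcup_k (cylinder n.+1 (set_coord x n.+1 k)).
Proof.
rewrite predeqE => w; split=> [xw|[k _ xw]].
  exists (U n.+1 w) => // i /andP[i0]; rewrite leq_eqVlt ltnS /set_coord.
  by case: eqP => [->//|/= _ i_n]; apply: xw; rewrite i0.
by move=> i i_n; rewrite (agree_set_coord x k i_n) (agree_le (leqnSn n) xw).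
Qed.

Lemma cylinder_set_coord n x k :
  cylinder n.+1 (set_coord x n.+1 k) = U n.+1 @^-1` [set k] `&` cylinder n x.
Proof.
rewrite predeqE => w; split=> [xw|[/= <- xw]].
  split; last by rewrite cylinderS; exists k.
  by have /= := xw n.+1; rewrite /set_coord eqxx ltnSn => ->.
move=> i /andP[i0]; rewrite leq_eqVlt ltnS /set_coord.
by case: eqP => [->//|/= _ i_n]; apply: xw; rewrite i0.
Qed.

End cylinders.

Section maximal_inequality.
Context d (T : measurableType d) (R : realType) (P : probability T R).
Context (m xi : nat) (v : m.-tuple 'I_3) (U : nat -> T -> nat).
Hypothesis UP : tangle_process P xi v U.

Let mU n : measurable_fun setT (U n). Proof. by case: UP. Qed.

Let pr A : R := fine (P A).

Let pr_ge0 A : 0 <= pr A. Proof. exact: fine_ge0. Qed.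

Let le_pr A B : measurable A -> measurable B -> A `<=` B -> pr A <= pr B.
Proof.
move=> mA mB AB; rewrite fine_le ?fin_num_measure//.
by rewrite le_measure// inE.
Qed.

Let pr_setU2 A B : measurable A -> measurable B -> pr (A `|` B) <= pr A + pr B.
Proof.
move=> mA mB; rewrite -fineD ?fin_num_measure// fine_le//.
- exact/fin_num_measure/measurableU.
- by rewrite fin_numD !fin_num_measure.
- exact: measureU2.
Qed.

Lemma agree_tangle_prob n x y k :
  agree n x y -> tangle_prob R m xi x n k = tangle_prob R m xi y n k.
Proof.
move=> xy; rewrite /tangle_prob (agree_tangleX _ _ xy).
by rewrite (agree_tangleW _ xy) (agree_tangleL _ _ xy).
Qed.

(** The conditional probability is constant on a cylinder, so integrating it
    there yields the Markov product rule. *)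
Lemma pr_cylinderS n x k : (m <= n)%N -> (k <= 2)%N ->
  pr (cylinder U n.+1 (set_coord x n.+1 k))
  = tangle_prob R m xi x n k * pr (cylinder U n x).
Proof.
move=> mn k2; have [_ _ _ /(_ n k mn k2)[_ _ condP]] := UP.
rewrite cylinder_set_coord /pr -condP; last exact: history_cylinder.
under eq_integral.
  move=> w /[!inE] xw; rewrite -(agree_tangle_prob k xw); over.
rewrite integral_cst ?fineM ?fin_num_measure//; exact: measurable_cylinder.
Qed.

(** Paths along which [X] drops below 1 are null, and are counted as deviating
    so that the transition rates are probabilities along all the others. *)
Definition deviates (c : R) (N : nat) (x : nat -> nat) : Prop :=
  exists2 k, (m <= k <= N)%N &
    tangleX m xi x k < 1 \/ c <= `|noise R m xi x k|.

Lemma agree_deviates c N x y : agree N x y -> deviates c N x -> deviates c N y.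
Proof.
move=> xy [k /andP[mk kN] xk]; exists k; first by rewrite mk.
have kxy := agree_le kN xy.
by rewrite -(agree_tangleX _ _ kxy) -(agree_noise _ _ _ kxy).
Qed.

Lemma deviatesS c n x : deviates c n.+1 x ->
  [\/ deviates c n x, tangleX m xi x n.+1 < 1 | c <= `|noise R m xi x n.+1|].
Proof.
move=> [k /andP[mk]]; rewrite leq_eqVlt => /predU1P[->|kn].
  by move=> [xn|xn]; [apply: Or32|apply: Or33].
by move=> xk; apply: Or31; exists k => //; rewrite mk.
Qed.

Let Dev c N : set T := [set w | deviates c N (U ^~ w)].

Let mDev c N : measurable (Dev c N).
Proof. exact: (measurable_finitary mU (@agree_deviates c N)). Qed.

(** Kolmogorov's maximal inequality, conditionally on a cylinder. The function
    [(noise ^ 2 + 4 r) / c ^ 2], with [r] the number of remaining steps, is a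
    supermartingale, and it is at least 1 once the noise has reached [c]; so it
    dominates the probability of ever reaching [c], by induction on [r]. *)
Lemma pr_deviates_cylinder c r n x : 0 < c -> (m <= n)%N ->
    ~ deviates c n x ->
  pr (cylinder U n x `&` Dev c (n + r))
  <= pr (cylinder U n x) * ((noise R m xi x n ^+ 2 + 4 * r%:R) / c ^+ 2).
Proof.
move=> c0; have c20 : 0 < c ^+ 2 by rewrite exprn_gt0.
elim: r n x => [|r IH] n x mn ndev.
  rewrite addn0 (_ : _ `&` _ = set0); last first.
    rewrite -subset0 => w [xw /=]; apply: contra_not ndev.
    by apply: agree_deviates; exact: agree_sym.
  rewrite [pr set0]/pr measure0 mulr_ge0 ?pr_ge0// divr_ge0 ?(ltW c20)//.
  by rewrite addr_ge0 ?sqr_ge0 ?mulr_ge0.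
have Xx : 1 <= tangleX m xi x n.
  rewrite leNgt; apply/negP => X1; apply: ndev.
  by exists n; [rewrite mn/=|left].
have [p_ge0 p_sum p_mean p_dev] := tangle_prob_moments R Xx.
set p := tangle_prob R m xi x n in p_ge0 p_sum p_mean *.
set S := noise R m xi x n; set mu := drift R m xi x n in p_mean p_dev.
pose y k := set_coord x n.+1 k.
have mCD k : measurable (cylinder U n.+1 (y k) `&` Dev c (n + r.+1)).
  by apply: measurableI => //; exact: measurable_cylinder.
have step k : (k <= 2)%N ->
    pr (cylinder U n.+1 (y k) `&` Dev c (n + r.+1)) <=
    p k * pr (cylinder U n x) * (((S + (k%:R - mu)) ^+ 2 + 4 * r%:R) / c ^+ 2).
  move=> k2; have xy : agree n x (y k) by exact: agree_set_coord.
  rewrite -pr_cylinderS//.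
  have -> : S + (k%:R - mu) = noise R m xi (y k) n.+1.
    rewrite noiseS// -(agree_noise _ _ _ xy) -(agree_drift _ _ _ xy).
    by rewrite /y /set_coord eqxx.
  have leC : pr (cylinder U n.+1 (y k) `&` Dev c (n + r.+1))
      <= pr (cylinder U n.+1 (y k)).
    by apply: le_pr => //; exact: measurable_cylinder.
  (* [X] can only leave [[1, +oo[] by a step that has probability 0. *)
  have [X1|X1] := ltP (tangleX m xi (y k) n.+1) 1.
    suff pk0 : p k = 0.
      by move: leC; rewrite pr_cylinderS// -/p pk0 !mul0r.
    move: X1; rewrite tangleXS// -(agree_tangleX _ _ xy) {1}/y /set_coord eqxx.
    move=> X1; have [-> Xk] : k = 2%N /\ tangleX m xi x n = 1 by lia.
    by rewrite /p /tangle_prob Xk subrr mulr0 mul0r.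
  have [cS|cS] := leP c `|noise R m xi (y k) n.+1|.
    apply: (le_trans leC); rewrite ler_peMr//.
    rewrite ler_pdivlMr// mul1r -[X in _ <= X + _]real_normK ?num_real//.
    rewrite -[X in X <= _]addr0 lerD ?mulr_ge0//.
    by rewrite ler_sqr ?nnegrE// ltW.
  rewrite -addSnnS; apply: IH; first exact: leqW.
  move=> /deviatesS[|/lt_geF|/le_gtF]; rewrite ?X1 ?cS//.
  by move/(agree_deviates (agree_sym xy)).
have cover : cylinder U n x `&` Dev c (n + r.+1) `<=`
    \big[setU/set0]_(k < 3) (cylinder U n.+1 (y k) `&` Dev c (n + r.+1)).
  move=> w [xw Dw].
  rewrite -(bigcup_mkord 3
    (fun k => cylinder U n.+1 (y k) `&` Dev c (n + r.+1))).
  exists (U n.+1 w).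
    by rewrite /= ltnS; case: UP => _ + _ _; exact.
  split=> //; rewrite /y cylinder_set_coord; by split.
apply: le_trans (le_pr _ _ cover) _.
- by apply: measurableI => //; exact: measurable_cylinder.
- by apply: bigsetU_measurable.
rewrite !big_ord_recr big_ord0/= set0U.
apply: le_trans (pr_setU2 _ _) _; [exact: measurableU|exact: mCD|].
apply: le_trans (lerD (pr_setU2 _ _) (lexx _)) _; [exact: mCD|exact: mCD|].
apply: le_trans (lerD (lerD (step 0%N _) (step 1%N _)) (step 2%N _)) _ => //.
set q := pr (cylinder U n x).
have q0 : 0 <= q by exact: pr_ge0.
rewrite !mulrA -!mulrDl ler_pM2r ?invr_gt0//.
have -> : forall z0 z1 z2, p 0%N * q * z0 + p 1%N * q * z1 + p 2%N * q * z2
   = q * (p 0%N * z0 + p 1%N * z1 + p 2%N * z2) by move=> *; ring.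
rewrite ler_wpM2l//.
have sq2 k : (k <= 2)%N -> (k%:R - mu) ^+ 2 <= 4.
  move=> k2; rewrite -real_normK ?num_real// (_ : 4 = 2 ^+ 2)//; last by ring.
  by rewrite ler_sqr ?nnegrE// p_dev.
have [s0 s1 s2] := And3 (sq2 0%N isT) (sq2 1%N isT) (sq2 2%N isT).
have [p0 p1 p2] := And3 (p_ge0 0%N) (p_ge0 1%N) (p_ge0 2%N).
(* The cross term vanishes because [drift] is the conditional mean. *)
have -> : p 0%N * ((S + (0%:R - mu)) ^+ 2 + 4 * r%:R)
   + p 1%N * ((S + (1%:R - mu)) ^+ 2 + 4 * r%:R)
   + p 2%N * ((S + (2%:R - mu)) ^+ 2 + 4 * r%:R)
   = (p 0%N + p 1%N + p 2%N) * (S ^+ 2 + 4 * r%:R - 2 * S * mu)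
   + 2 * S * (p 1%N + 2 * p 2%N)
   + (p 0%N * (0%:R - mu) ^+ 2 + p 1%N * (1%:R - mu) ^+ 2
     + p 2%N * (2%:R - mu) ^+ 2) by ring.
rewrite p_sum p_mean -[r.+1]addn1 natrD.
have h0 := ler_wpM2l p0 s0; have h1 := ler_wpM2l p1 s1.
have h2 := ler_wpM2l p2 s2.
by lra.
Qed.

Lemma prob_deviates_le c N : 0 < c -> (0 < xi)%N -> (m <= N)%N ->
  (P [set w | deviates c N (U ^~ w)] <= (4 * (N - m)%:R / c ^+ 2)%:E)%E.
Proof.
move=> c0 xi0 mN; rewrite -[P _]fineK ?fin_num_measure//; last exact: mDev.
have [_ _ Uv _] := UP.
pose x := U ^~ (point : T).
(* Up to step [m] the path is deterministic: its cylinder is the full space. *)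
have CT : cylinder U m x = setT.
  rewrite predeqE => w; split=> // _ [//|i] im.
  by have /= := Uv (Ordinal im) => e; rewrite /x !e.
have := @pr_deviates_cylinder c (N - m) m x c0 (leqnn m).
rewrite CT setTI subnKC// /pr probability_setT mul1r noise_init expr0n add0r.
rewrite lee_fin; apply.
move=> [k]; rewrite -eqn_leq => /eqP <-; rewrite tangleX_init noise_init.
by rewrite normr0; case; [lia|rewrite leNgt c0].
Qed.

End maximal_inequality.

(** * The fluid equations *)

Lemma compact_uniform_continuity (R : realType) (K : set R) (f : R -> R) :
    compact K -> {within K, continuous f} ->
  forall e, 0 < e -> exists2 r, 0 < r &
    forall x y, K x -> K y -> `|x - y| < r -> `|f x - f y| < e.
Proof.
move=> /compact_near_coveringP/near_covering_withinP cK.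
move=> /subspace_continuousP cf e e0.
have e20 : 0 < e / 2 by rewrite divr_gt0.
have := cK R 0^'+ (fun r x => forall y, K y -> `|x - y| < r -> `|f x - f y| < e)
  _.
case=> [|r /= r0 rP].
  move=> x Kx; have /cvgrPdist_lt/(_ _ e20) := cf x Kx.
  rewrite near_withinE => /nbhs_ballP[s /= s0 sP].
  have s20 : 0 < s / 2 by rewrite divr_gt0.
  exists (ball x (s / 2), [set r | r < s / 2]).
    by split; [exact: nbhsx_ballx|exact: nbhs_right_lt].
  move=> [z r]/= [xz rs] Kz y Ky zy.
  have fz : `|f x - f z| < e / 2.
    by apply: sP => //; rewrite /ball/= (lt_trans xz)//; lra.
  have fy : `|f x - f y| < e / 2.
    apply: sP => //; rewrite /ball/=.
    rewrite (_ : x - y = (x - z) + (z - y)); last by ring.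
    rewrite (le_lt_trans (ler_normD _ _))//.
    by move: xz zy; rewrite /ball/=; lra.
  rewrite (_ : f z - f y = (f x - f y) - (f x - f z)); last by ring.
  by rewrite (le_lt_trans (ler_normB _ _))//; lra.
have r20 : 0 < r / 2 by rewrite divr_gt0.
exists (r / 2) => // x y Kx Ky xy.
by apply: (rP (r / 2)) => //=; rewrite sub0r normrN gtr0_norm//; lra.
Qed.

Lemma is_derive_Rintegral (R : realType) (f : R -> R) (x y t : R) :
    {within `[x, y], continuous f} -> x < t < y ->
  is_derive t 1 (fun z => \int[@lebesgue_measure R]_(s in `[x, z]) f s) (f t).
Proof.
move=> cf /andP[xt ty]; have xy := lt_trans xt ty.
have intf : (@lebesgue_measure R).-integrable `[x, y] (EFin \o f).
  by apply: continuous_compact_integrable cf; exact: segment_compact.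
have ft : {for t, continuous f}.
  by apply: within_continuous_continuous cf _ => //; rewrite in_itv/= xt.
have [df f'] := continuous_FTC1_closed ty intf xt ft.
by apply: DeriveDef; [exact: df|rewrite -derive1E].
Qed.

Lemma gt0_derive_lt_left (R : realType) (f : R -> R) (x c df : R) :
    x < c -> is_derive c 1 f df -> 0 < df ->
  exists2 y, x < y < c & f y < f c.
Proof.
move=> xc [fc fdf] df0.
have : h^-1 *: (f (h *: 1 + c) - f c) @[h --> 0^'] --> df by rewrite -fdf.
move=> /cvgr_gt/(_ _ df0); rewrite near_withinE => /nbhs_ballP[e /= e0 eP].
pose r := Num.min e (c - x) / 2.
have r0 : 0 < r by rewrite divr_gt0// lt_min e0 subr_gt0.
have [re rx] : r < e /\ r < c - x.
  have m0 : 0 < Num.min e (c - x) by rewrite lt_min e0 subr_gt0.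
  have := lexx (Num.min e (c - x)); rewrite {2}/Num.min /r.
  by rewrite le_min => /andP[]; split; lra.
exists (c - r); first by apply/andP; split; lra.
have := eP (- r); rewrite /ball/= sub0r opprK gtr0_norm// => /(_ re).
rewrite oppr_eq0 gt_eqF// => /(_ isT).
rewrite /GRing.scale/= mulr1 invrN mulNr oppr_gt0 pmulr_rlt0 ?invr_gt0//.
by rewrite subr_lt0 addrC.
Qed.

Section fluid.
Context (R : realType) (h a0 : R) (u a b : R -> R).
Hypotheses (h0 : 0 < h) (alphaP : dde_init h a0 u).
Hypothesis abP : fluid_solution h a0 u a b.

Let a00 : 0 < a0. Proof. by case: alphaP. Qed.

Lemma fluid_continuous x y : h <= x ->
  {within `[x, y], continuous a} /\ {within `[x, y], continuous b}.
Proof.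
move=> hx; have [[ca cb] _ _ _] := abP.
have sub : `[x, y] `<=` `[h, +oo[.
  by move=> z; rewrite /= !in_itv/= andbT => /andP[/(le_trans hx)].
by split; exact: continuous_subspaceW sub _.
Qed.

Lemma fluid_b_start t : h <= t <= 2 * h -> a0 <= b t.
Proof.
move=> t2; have [_ bE _ _] := abP; rewrite bE//.
have [_ _ u02] := alphaP.
suff : 0 <= \int[@lebesgue_measure R]_(s in `[t - h, h]) u s by lra.
apply: Rintegral_ge0 => s; rewrite /= in_itv/= => /andP[s1 s2].
by have /andP[] : 0 <= u s <= 2 by apply: u02; lra.
Qed.

Lemma fluid_b_2h : b (2 * h) = a0 + h.
Proof.
have [_ bE _ _] := abP; rewrite bE; last by move: h0; lra.
rewrite (_ : 2 * h - h = h); last by ring.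
by rewrite set_itv1 Rintegral_set1; ring.
Qed.

Lemma fluid_a_h : a h = a0.
Proof.
have [_ _ aE _] := abP; rewrite aE; last by move: h0; lra.
rewrite set_itv1 Rintegral_set1 mulr0 addr0 /fluid_P.
by rewrite set_itv1 Rintegral_set1 mulr0 expR0 invr1 mul1r.
Qed.

Lemma fluid_P_gt0 x y : 0 < fluid_P b x y.
Proof. exact: expR_gt0. Qed.

Lemma fluid_a_start_gt0 t : h <= t <= 2 * h -> 0 < a t.
Proof.
move=> t2; have [_ _ aE _] := abP; rewrite aE//.
have iP := fluid_P_gt0 h t; rewrite -invr_gt0 in iP.
rewrite ltr_wpDr// ?mulr_gt0// mulr_ge0// ?(ltW iP)//.
by apply: Rintegral_ge0 => s _; rewrite ltW// fluid_P_gt0.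
Qed.

(** On [[h, 2h]] the integral formula solves, by variation of constants, the
    differential equation that is imposed after [2h]. *)
Lemma fluid_a_derive_start t : h < t < 2 * h ->
  is_derive t 1 a (1 - 2 * (a t / b t)).
Proof.
move=> ht; have [_ _ aE _] := abP.
have h2 : h <= 2 * h by move: h0; lra.
have ht' : h <= t <= 2 * h by lra.
have ci : {within `[h, 2 * h], continuous (fun s => (b s)^-1)}.
  apply/subspace_continuousP => x /= xh; apply: cvgV.
    by rewrite gt_eqF// (lt_le_trans a00)// fluid_b_start.
  have [_ /subspace_continuousP] := @fluid_continuous h (2 * h) (lexx h).
  exact.
have cP : {within `[h, 2 * h], continuous (fluid_P b h)}.
  have intb : (@lebesgue_measure R).-integrable `[h, 2 * h]
      (EFin \o (fun s => (b s)^-1)).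
    by apply: continuous_compact_integrable ci; exact: segment_compact.
  have /subspace_continuousP cI := parameterized_integral_continuous h2 intb.
  apply/subspace_continuousP => x /cI Ix; rewrite /fluid_P.
  by apply: continuous_cvg; [exact: continuous_expR|exact: cvgMl_tmp].
have DI := is_derive_Rintegral ci ht.
have DP : is_derive t 1 (fluid_P b h) (fluid_P b h t * (2 *: (b t)^-1)).
  apply: (@is_derive1_comp _ expR
    (2 \*: (fun z => \int[lebesgue_measure]_(s in `[h, z]) (b s)^-1))).
have DQ := is_derive_Rintegral cP ht.
have P0 := fluid_P_gt0 h t.
have Pn0 : fluid_P b h t != 0 by rewrite gt_eqF.
pose I z := \int[@lebesgue_measure R]_(s in `[h, z]) fluid_P b h s.
apply: (@near_eq_is_derive _ _ _
  ((fun z => (fluid_P b h z)^-1) * (cst a0 + I))).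
  near=> z; rewrite aE ?mulrDr//.
  apply/andP; split; apply: ltW; near: z.
    by apply: lt_nbhsr; case/andP: ht.
  by apply: lt_nbhsl; case/andP: ht.
have D1 : is_derive t 1 (fun z => (fluid_P b h z)^-1) _ := is_deriveV Pn0 DP.
have D2 : is_derive t 1 (cst a0 + I) _ := is_deriveD (is_derive_cst a0 t 1) DQ.
apply: is_derive_eq (is_deriveM D1 D2) _.
rewrite add0r aE// /GRing.scale/= !fctE.
have : b t != 0 by rewrite gt_eqF// (lt_le_trans a00)// fluid_b_start.
rewrite -/(I t); move: Pn0; move: (fluid_P b h t) (I t) (b t) => p q B p0 B0.
by field; rewrite p0 B0.
Unshelve. all: by end_near. Qed.

Lemma fluid_a_derive t : h < t -> t != 2 * h ->
  is_derive t 1 a (1 - 2 * (a t / b t)).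
Proof.
move=> ht; rewrite neq_lt => /orP[t2|t2].
  by apply: fluid_a_derive_start; rewrite ht.
by have [_ _ _ /(_ _ t2)[]] := abP.
Qed.

(** The counterpart of [tangleL_delay]: [b (t + h)] and [a t] have the same
    derivative. The point [2h], where [a] need not be differentiable a priori,
    is avoided by treating [[h, 2h]] and [[2h, +oo[] separately. *)
Lemma fluid_b_delay t : h <= t -> b (t + h) = a t + h.
Proof.
move=> ht; have h0' := h0; pose g s := b (s + h) - a s.
have cst_g x y : h <= x <= y -> (y <= 2 * h \/ 2 * h <= x) -> g x = g y.
  move=> /andP[hx xy] xy2.
  have Dg s : s \in `]x, y[ -> is_derive s 1 g 0.
    rewrite in_itv/= => /andP[xs sy].
    have hs : h < s by lra.
    have s2 : s != 2 * h by rewrite neq_lt; apply/orP; case: xy2; lra.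
    have [_ _ _ /(_ (s + h))[|_ +]] := abP; first by lra.
    rewrite addrK => Db; have Da := fluid_a_derive hs s2.
    have Dh : is_derive s 1 (id + cst h) _ :=
      is_deriveD (is_derive_id s 1) (is_derive_cst h s 1).
    have Dbh : is_derive s 1 (b \o (id + cst h)) _ :=
      @is_derive1_comp _ b (id + cst h) s _ _ Db Dh.
    by apply: is_derive_eq (is_deriveB Dbh Da) _; ring.
  have cg : {within `[x, y], continuous g}.
    apply/subspace_continuousP => s xys; apply: cvgB; last first.
      by have [/subspace_continuousP + _] := fluid_continuous y hx; exact.
    apply: cvg_within_filter; apply: (@continuous_comp _ _ _ (+%R^~ h) b).
      by apply: cvgD; [exact: cvg_id|exact: cvg_cst].
    have [[_ /continuous_within_itvcyP[cb _]] _ _ _] := abP.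
    apply: cb; rewrite in_itv/= andbT.
    by move: xys; rewrite /= in_itv/=; lra.
  have [s _] := MVT_segment xy Dg cg.
  by rewrite mul0r => /eqP; rewrite subr_eq0 => /eqP.
suff : g t = h by rewrite /g => /eqP; rewrite subr_eq [h + _]addrC => /eqP.
have gh : g h = h.
  have hh : h + h = 2 * h by ring.
  by rewrite /g fluid_a_h hh fluid_b_2h; ring.
have [t2|t2] := leP t (2 * h).
  by rewrite -(cst_g h t) ?lexx//; left.
rewrite -(cst_g (2 * h) t); last 2 first.
- by apply/andP; split; lra.
- by right.
by rewrite -(cst_g h (2 * h)) ?lexx//; lra.
Qed.

(** Induction on intervals of length [h]: the sign of [a] up to time [t] gives
    that of [b] up to time [t + h]. While [b] is positive, [a' >= 1] wherever
    [a <= 0], so [a] cannot attain a nonpositive minimum. *)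
Lemma fluid_gt0 t : h <= t -> 0 < a t /\ 0 < b t.
Proof.
have h0' := h0.
have [b_gt0 b_delay] : (forall t, h <= t <= 2 * h -> 0 < b t) /\
    (forall t, 2 * h <= t -> b t = a (t - h) + h).
  split=> s s2; first exact: lt_le_trans a00 (fluid_b_start s2).
  by rewrite -fluid_b_delay ?subrK//; lra.
have a_gt0 k s : h <= s <= (k.+2)%:R * h -> 0 < a s.
  elim: k s => [|k IH] s sk; first exact: fluid_a_start_gt0.
  have [s2|s2] := leP s (2 * h); first by apply: fluid_a_start_gt0; lra.
  have h2 : h <= 2 * h by lra.
  have [ca _] := fluid_continuous s h2; have [c] := EVT_min (ltW s2) ca.
  rewrite in_itv/= => /andP[c2 cs] cmin.
  suff : 0 < a c.
    by move=> /lt_le_trans; apply; apply: cmin; rewrite in_itv/=; lra.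
  rewrite ltNge; apply/negP => ac0.
  have a2 : 0 < a (2 * h) by apply: fluid_a_start_gt0; lra.
  have c2' : 2 * h < c.
    by rewrite lt_neqAle c2 andbT; apply: contraTneq ac0 => <-; rewrite -ltNge.
  have bc : 0 < b c.
    rewrite b_delay// ltr_wpDl// ltW// IH//.
    by move: sk; rewrite -addn1 natrD; lra.
  have dac : 0 < 1 - 2 * (a c / b c).
    suff : a c / b c <= 0 by lra.
    by rewrite ler_pdivrMr// mul0r.
  have Dc : is_derive c 1 a (1 - 2 * (a c / b c)).
    by apply: fluid_a_derive; [lra|rewrite gt_eqF].
  have [y yc] := gt0_derive_lt_left c2' Dc dac.
  by rewrite ltNge cmin// in_itv/=; lra.
move=> ht.
have a0t s : h <= s -> 0 < a s.
  move=> hs; apply: (a_gt0 (Num.truncn (s / h))); rewrite hs/=.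
  have := ltW (truncnS_gt (s / h)).
  by rewrite ler_pdivrMr// -addn1 natrD; lra.
split; first exact: a0t.
have [t2|t2] := leP t (2 * h); first by apply: b_gt0; rewrite ht.
by rewrite b_delay ?ltW// ltr_wpDl// ltW// a0t//; lra.
Qed.

Lemma fluid_b_lower T : h <= T ->
  exists2 beta, 0 < beta & forall t, h <= t <= T -> beta <= b t.
Proof.
move=> hT; have [_ cb] := @fluid_continuous h T (lexx h).
have [c cT cmin] := EVT_min hT cb.
exists (b c).
  by have [] := @fluid_gt0 c; first by move: cT; rewrite in_itv/= => /andP[].
by move=> t tT; apply: cmin; rewrite in_itv.
Qed.

End fluid.

(** * Comparison of good paths with the fluid limit *)

(** A bound on [z] by an earlier [y] costs no more than a bound by the current
    one, because the majorant of [y] is nondecreasing; this is why the growth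
    factor is [1 + 2 K]. *)
Lemma delayed_gronwall (R : realType) (y z : nat -> R) (D K g : R) (m N : nat) :
    0 <= K -> 0 <= g -> 0 <= D ->
    (forall n, (m <= n <= N)%N ->
       y n <= D + K * \sum_(m <= k < n) (y k + z k)) ->
    (forall n, (m <= n <= N)%N ->
       z n <= g \/ exists2 j, (m <= j <= n)%N & z n <= y j) ->
  forall n, (m <= n <= N)%N ->
    y n <= (D + K * (N - m)%:R * g) * (1 + 2 * K) ^+ (n - m).
Proof.
move=> K0 g0 D0 yS zy; set E := D + _; set q := 1 + 2 * K.
have E0 : 0 <= E by rewrite addr_ge0// !mulr_ge0.
have q1 : 1 <= q by rewrite lerDl mulr_ge0.
elim/ltn_ind => n IH /andP[mn nN].
have step k : (m <= k < n)%N -> y k + z k <= g + 2 * E * q ^+ (k - m).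
  move=> /andP[mk kn]; have kN : (m <= k <= N)%N.
    by rewrite mk (leq_trans (ltnW kn)).
  have yk := IH k kn kN.
  suff zk : z k <= g + E * q ^+ (k - m) by lra.
  have [zg|[j /andP[mj jk] zj]] := zy k kN.
    by rewrite (le_trans zg)// lerDl mulr_ge0// exprn_ge0// (le_trans _ q1).
  rewrite (le_trans zj)// (le_trans (IH j _ _))//.
  - exact: leq_ltn_trans kn.
  - by rewrite mj; case/andP: kN => _; exact: leq_trans.
  - by rewrite -[leLHS]add0r lerD// ler_wpM2l// ler_weXn2l// leq_sub2r.
have sum_step : \sum_(m <= k < n) (y k + z k)
    <= \sum_(m <= k < n) (g + 2 * E * q ^+ (k - m)).
  by rewrite big_nat [leRHS]big_nat ler_sum.
have geo l : K * \sum_(m <= k < m + l) (g + 2 * E * q ^+ (k - m))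
    = K * l%:R * g + E * q ^+ l - E.
  elim: l => [|l IHl]; first by rewrite addn0 big_geq// expr0; ring.
  rewrite addnS big_nat_recr ?leq_addr//= mulrDr IHl addKn.
  by rewrite exprS -[l.+1]addn1 natrD {3}/q; ring.
have := ler_wpM2l K0 sum_step; rewrite -{2}(subnKC mn) geo => sumE.
have nm : K * (n - m)%:R * g <= K * (N - m)%:R * g.
  by rewrite ler_wpM2r// ler_wpM2l// ler_nat leq_sub2r.
have := yS n; rewrite mn nN => /(_ isT); rewrite /E; move: sumE; rewrite /E.
by lra.
Qed.

Section good_paths.
Context (R : realType) (h a0 : R) (u a b : R -> R).
Hypotheses (h0 : 0 < h) (alphaP : dde_init h a0 u).
Hypothesis abP : fluid_solution h a0 u a b.

Let a00 : 0 < a0. Proof. by case: alphaP. Qed.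

Lemma fluid_increment s t : h <= s < t -> (t <= 2 * h \/ 2 * h <= s) ->
  exists2 c, s < c < t & a t - a s = (t - s) * (1 - 2 * (a c / b c)).
Proof.
move=> /andP[hs st] st2.
have [ca _] := fluid_continuous abP t hs.
have Da r : r \in `]s, t[ -> is_derive r 1 a (1 - 2 * (a r / b r)).
  rewrite in_itv/= => /andP[sr rt]; apply: (fluid_a_derive h0 alphaP abP).
    exact: le_lt_trans sr.
  by rewrite neq_lt; apply/orP; case: st2; lra.
have [c cst ->] := MVT st Da ca.
by exists c; [move: cst; rewrite in_itv|rewrite mulrC].
Qed.

Context (T beta omega lambda : R) (m : nat) (v : m.-tuple 'I_3).
Hypotheses (beta0 : 0 < beta) (omega0 : 0 <= omega).
Hypothesis b_lower : forall t, h <= t <= T -> beta <= b t.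
Hypothesis ratio_osc : forall s t, h <= s <= T -> h <= t <= T ->
  `|s - t| < lambda^-1 -> `|a s / b s - a t / b t| <= omega.
Hypotheses (lambda0 : 0 < lambda) (lh : lambda * h = m%:R).
Hypothesis vF : F_init h a0 b lambda v.

Let xi := xi_init lambda a0.
Let kappa : R := 4 * Num.sqrt h * (Num.sqrt lambda)^-1 + lambda^-1.
Let N := Num.truncn (lambda * T).
Let time (n : nat) : R := lambda^-1 * n%:R.

Lemma xi_init_near : `|xi%:R - lambda * a0| <= 1.
Proof.
have la0 : 0 < lambda * a0 by rewrite mulr_gt0.
have /andP[] := truncn_itv (ltW la0).
rewrite /xi /xi_init; case: (Num.truncn _) => [|k] k1 k2.
  by rewrite max0n ler_norml; move: k2; lra.
rewrite (maxn_idPl _)//; move: k2; rewrite -[k.+2]addn1 natrD ler_norml; lra.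
Qed.

Lemma xi_init_lower : lambda * (a0 / 2) <= xi%:R.
Proof.
have la0 : 0 < lambda * a0 by rewrite mulr_gt0.
have /andP[_] := truncn_itv (ltW la0).
rewrite /xi /xi_init; case: (Num.truncn _) => [|k] k2.
  by rewrite max0n mulrA; lra.
rewrite (maxn_idPl _)//; move: k2; rewrite -[k.+2]addn1 natrD.
have : 1 <= k.+1%:R :> R by rewrite ler1n.
by rewrite mulrA; lra.
Qed.

Let time_m : time m = h.
Proof. by rewrite /time -lh mulKf// gt_eqF. Qed.

Let time_double : time (2 * m) = 2 * h.
Proof. by rewrite -time_m /time natrM; ring. Qed.

Let le_time k n : (time k <= time n) = (k <= n)%N.
Proof. by rewrite ler_pM2l ?invr_gt0// ler_nat. Qed.

Let timeS n : time n.+1 = time n + lambda^-1.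
Proof. by rewrite /time -addn1 natrD mulrDr mulr1. Qed.

Let timeD j k : time (j + k) = time j + time k.
Proof. by rewrite /time natrD mulrDr. Qed.

Let le_time_T n : 0 < T -> (n <= N)%N -> time n <= T.
Proof.
move=> T0; rewrite truncn_ge_nat ?mulr_ge0 ?(ltW lambda0) ?(ltW T0)// => nT.
by rewrite /time mulrC ler_pdivrMr// mulrC.
Qed.

Context (x : nat -> nat) (eta : R).
Hypothesis xv : forall i : 'I_m, x i.+1 = tnth v i.
Hypothesis T0 : 2 * h <= T.
Hypothesis good : ~ deviates m xi (eta * lambda) N x.

Let X n : R := (tangleX m xi x n)%:~R.
Let L n : R := (tangleL m xi x n)%:~R.
Let y n : R := `|X n - lambda * a (time n)|.
Let z n : R := `|L n - lambda * b (time n)|.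
Let c : R := Num.min h (a0 / 2).

Let T_gt0 : 0 < T. Proof. by rewrite (lt_le_trans _ T0)// mulr_gt0. Qed.

Let time_itv n : (m <= n <= N)%N -> h <= time n <= T.
Proof. by move=> /andP[mn nN]; rewrite -time_m le_time mn le_time_T. Qed.

Let c_gt0 : 0 < c. Proof. by rewrite lt_min h0 divr_gt0. Qed.

Lemma good_X n : (m <= n <= N)%N -> 1 <= tangleX m xi x n.
Proof.
by move=> mnN; rewrite leNgt; apply/negP => X1; apply: good; exists n; [|left].
Qed.

Lemma good_noise n : (m <= n <= N)%N -> `|noise R m xi x n| <= eta * lambda.
Proof.
move=> mnN; rewrite leNgt; apply/negP => /ltW X1.
by apply: good; exists n; [|right].
Qed.

(** This keeps the correction [X / L ^ 2 <= 1 / L] of order [1 / lambda]. Up to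
    step [2 m], [L] is at least [xi]; later on it is at least [m]. *)
Lemma good_L n : (m <= n <= N)%N -> c * lambda <= L n.
Proof.
move=> /andP[mn nN]; have [n2|n2] := leqP n (m + m).
  rewrite /L -(subnKC mn) (tangleL_init xi xv) ?leq_subLR// /initL.
  rewrite -pmulrn !natrD -addrA.
  apply: (@le_trans _ _ xi%:R); last by rewrite lerDl addr_ge0.
  apply: le_trans xi_init_lower; rewrite mulrC ler_wpM2l ?(ltW lambda0)//.
  by rewrite ge_min lexx orbT.
have mnm : (m <= n - m)%N by rewrite leq_subRL// ltnW.
rewrite /L -(subnK mn) tangleL_delay// rmorphD/= -pmulrn -lh.
have : 1 <= tangleX m xi x (n - m).
  by apply: good_X; rewrite mnm (leq_trans (leq_subr _ _)).
rewrite -(ler1z R) => X1.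
have : c * lambda <= lambda * h.
  by rewrite mulrC ler_wpM2l ?(ltW lambda0)// ge_min lexx.
by lra.
Qed.

(** Up to step [2 m] this is the assumption on [v]; afterwards, both delay
    identities apply. *)
Lemma good_z n : (m <= n <= N)%N ->
  z n <= kappa * lambda \/ exists2 j, (m <= j <= n)%N & z n <= y j.
Proof.
move=> /andP[mn nN]; have [n2|n2] := leqP n (m + m); [left|right].
  have jm : (n - m < m.+1)%N by rewrite ltnS leq_subLR.
  have := vF; rewrite /F_init -/kappa.
  move=> /(le_trans (le_bigmax _ _ (Ordinal jm)))/=.
  have LE : L n = (initL xi v (n - m))%:R.
    by rewrite /L -{1}(subnKC mn) (tangleL_init xi xv) ?leq_subLR// -pmulrn.
  rewrite -/xi -LE subnKC// -/(time n).
  rewrite -(ler_pM2r lambda0) => /(le_trans _); apply.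
  rewrite -[X in _ * X]gtr0_norm// -normrM mulrBl mulrAC mulVf ?gt_eqF// mul1r.
  by rewrite [b _ * _]mulrC.
exists (n - m)%N.
  by rewrite leq_subRL// (ltnW n2) leq_subr.
rewrite /z /y /L /X -{1 2}(subnK mn) tangleL_delay ?leq_subRL 1?ltnW//.
rewrite timeD time_m (fluid_b_delay h0 alphaP abP) -?time_m ?le_time;
  last first.
  by rewrite leq_subRL// ltnW.
rewrite rmorphD/= -pmulrn -lh time_m.
by rewrite (_ : _ - _ = X (n - m) - lambda * a (time (n - m)))// /X; ring.
exact: leq_ltn_trans (leq_addr m m) n2.
Qed.

Lemma good_ratio n : (m <= n <= N)%N ->
  `|X n / L n - a (time n) / b (time n)| <= (y n + z n) / (lambda * beta).
Proof.
move=> mnN; have bt := b_lower (time_itv mnN).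
have b0 : 0 < b (time n) by exact: lt_le_trans bt.
have L0 : 0 < L n by rewrite (lt_le_trans _ (good_L mnN))// mulr_gt0.
have /andP[r0 r1] := ratio_le1 R (good_X mnN).
rewrite -/(X n) -/(L n) in r0 r1.
(* In this decomposition [L] is never a bare denominator: it occurs only in
   the ratio [X / L], which lies between 0 and 1. *)
rewrite (_ : _ - _ = ((X n - lambda * a (time n))
   - X n / L n * (L n - lambda * b (time n))) / (lambda * b (time n))).
  rewrite normrM normfV ler_pM//.
    rewrite (le_trans (ler_normB _ _))// lerD2l normrM ger0_norm//.
    by rewrite ler_piMl.
  rewrite gtr0_norm ?mulr_gt0// lef_pV2 ?posrE ?mulr_gt0//.
  by rewrite ler_pM2l.
by field; rewrite !gt_eqF.
Qed.

(** One step of the Euler scheme, by the mean value theorem for [a]; it applies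
    at every step since [2h], where the equation changes, is a grid point. *)
Lemma good_step n : (m <= n < N)%N ->
  `|(1 - drift R m xi x n) - lambda * (a (time n.+1) - a (time n))|
  <= 2 / (lambda * beta) * (y n + z n) + (2 * omega + (c * lambda)^-1).
Proof.
move=> /andP[mn nN]; have mnN : (m <= n <= N)%N by rewrite mn ltnW.
have mSN : (m <= n.+1 <= N)%N by rewrite nN leqW.
have /andP[hn nT] := time_itv mnN; have /andP[hS ST] := time_itv mSN.
have lV : 0 < lambda^-1 by rewrite invr_gt0.
have [s /andP[ns sS] ->] : exists2 s, time n < s < time n.+1 &
    a (time n.+1) - a (time n)
    = (time n.+1 - time n) * (1 - 2 * (a s / b s)).
  apply: fluid_increment; first by rewrite hn timeS ltrDl.
  by rewrite -time_double !le_time; case: (ltnP n (2 * m)); [left|right].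
have -> : time n.+1 - time n = lambda^-1 by rewrite timeS addrC addKr.
rewrite mulrA divff ?gt_eqF// mul1r.
have osc : `|a s / b s - a (time n) / b (time n)| <= omega.
  apply: ratio_osc; [by apply/andP; split; lra|by rewrite hn|].
  by move: sS; rewrite timeS ltr_norml; lra.
have L0 : 0 < L n by rewrite (lt_le_trans _ (good_L mnN))// !mulr_gt0.
have X1 := good_X mnN.
have /andP[r0 r1] := ratio_le1 R X1; rewrite -/(X n) -/(L n) in r0 r1.
have rL : X n / L n ^+ 2 <= (c * lambda)^-1.
  rewrite expr2 invfM mulrA -[leRHS]mul1r ler_pM ?invr_ge0 ?(ltW L0)//.
  by rewrite lef_pV2 ?posrE ?mulr_gt0// good_L.
have rL0 : 0 <= X n / L n ^+ 2.
  by rewrite expr2 invfM mulrA mulr_ge0// invr_ge0 ltW.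
have := good_ratio mnN.
rewrite /drift -/(X n) -/(L n) -mulrA.
move: osc rL rL0; move: (X n / L n ^+ 2) (X n / L n) (a s / b s) => r2 r rs.
rewrite [_ / (_ * _)]mulrC [2 / _]mulrC -mulrA [_ * (2 * _)]mulrCA.
move: (_^-1 * (y n + z n)) (a (time n) / b (time n)) => e rn.
move: (c * lambda)^-1 => d.
rewrite !ler_norml => /andP[p1 p2] d1 d2 /andP[q1 q2]; apply/andP; split; lra.
Qed.

(* The sources of error: the rounding in [xi], the local errors of the Euler
   scheme, and the noise. *)
Let D := 1 + N%:R * (2 * omega + (c * lambda)^-1) + eta * lambda.

Lemma good_sum n : (m <= n <= N)%N ->
  y n <= D + 2 / (lambda * beta) * \sum_(m <= k < n) (y k + z k).
Proof.
move=> mnN; have /andP[mn nN] := mnN.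
have tele : a (time n) = a0
    + \sum_(m <= k < n) (a (time k.+1) - a (time k)).
  by rewrite telescope_sumr// time_m (fluid_a_h h0 abP); ring.
have d0 : 0 <= 2 * omega + (c * lambda)^-1.
  by rewrite addr_ge0 ?mulr_ge0// invr_ge0 mulr_ge0 ?ltW.
rewrite /y /X tangleX_noise// tele.
rewrite (_ : _ - _ = (xi%:R - lambda * a0)
  + \sum_(m <= k < n) ((1 - drift R m xi x k)
      - lambda * (a (time k.+1) - a (time k)))
  - noise R m xi x n); last first.
  by rewrite [in RHS]sumrB -[in RHS]mulr_sumr; ring.
rewrite (le_trans (ler_normB _ _))//.
have S1 := good_noise mnN; have X1 := xi_init_near.
suff : `|\sum_(m <= k < n) ((1 - drift R m xi x k)
      - lambda * (a (time k.+1) - a (time k)))|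
    <= N%:R * (2 * omega + (c * lambda)^-1)
       + 2 / (lambda * beta) * \sum_(m <= k < n) (y k + z k).
  move=> S2; rewrite (le_trans (lerD (ler_normD _ _) (lexx _)))// /D.
  by lra.
rewrite (le_trans (ler_norm_sum _ _ _))//.
apply: (@le_trans _ _ (\sum_(m <= k < n) (2 / (lambda * beta) * (y k + z k)
    + (2 * omega + (c * lambda)^-1)))).
  rewrite big_nat [leRHS]big_nat ler_sum// => k /andP[mk kn].
  by rewrite good_step// mk (leq_trans kn).
rewrite big_split/= -mulr_sumr [leLHS]addrC lerD2r sumr_const_nat.
rewrite -[leLHS]mulr_natl.
by rewrite ler_wpM2r// ler_nat (leq_trans (leq_subr _ _)).
Qed.

(** Gronwall with [K = 2 / (lambda * beta)] over at most [lambda * T] steps: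
    the growth factor is at most [exp (2 K lambda T) = exp (4 T / beta)]. *)
Lemma good_close n : (m <= n <= N)%N ->
  `|lambda^-1 * X n - a (time n)| <= expR (4 * T / beta) *
     (lambda^-1 + T * (2 * omega + (c * lambda)^-1) + eta
      + 2 * T / beta * kappa).
Proof.
move=> mnN; have /andP[mn nN] := mnN.
have eta0 : 0 <= eta * lambda by exact: le_trans (good_noise mnN).
have d0 : 0 <= 2 * omega + (c * lambda)^-1.
  by rewrite addr_ge0 ?mulr_ge0// invr_ge0 mulr_ge0 ?ltW.
have k0 : 0 <= kappa * lambda.
  have l0 := ltW lambda0; apply: mulr_ge0 => //; apply: addr_ge0.
    by rewrite !mulr_ge0 ?invr_ge0 ?sqrtr_ge0.
  by rewrite invr_ge0.
have K0 : 0 <= 2 / (lambda * beta).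
  by rewrite divr_ge0// mulr_ge0 ?(ltW lambda0) ?(ltW beta0).
have K20 : 0 <= 2 * (2 / (lambda * beta)) by exact: mulr_ge0.
have D0 : 0 <= D by rewrite !addr_ge0// mulr_ge0.
have NT : N%:R <= lambda * T.
  by rewrite -truncn_ge_nat ?mulr_ge0 ?(ltW lambda0) ?(ltW T_gt0).
have := delayed_gronwall K0 k0 D0 good_sum good_z mnN.
have eM : (1 + 2 * (2 / (lambda * beta))) ^+ (n - m) <= expR (4 * T / beta).
  apply: (@le_trans _ _ (expR (2 * (2 / (lambda * beta))) ^+ (n - m))).
    by rewrite lerXn2r ?nnegrE ?expR_ge0 ?expR_ge1Dx// addr_ge0.
  rewrite -expRM_natl ler_expR.
  apply: (@le_trans _ _ (lambda * T * (2 * (2 / (lambda * beta))))).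
    rewrite ler_wpM2r// (le_trans _ NT)// ler_nat.
    exact: leq_trans (leq_subr _ _) nN.
  rewrite le_eqVlt; apply/orP; left; apply/eqP.
  by field; rewrite !gt_eqF.
have DE : D + 2 / (lambda * beta) * (N - m)%:R * (kappa * lambda) <=
    lambda * (lambda^-1 + T * (2 * omega + (c * lambda)^-1) + eta
      + 2 * T / beta * kappa).
  have NmT : (N - m)%:R <= lambda * T :> R.
    by rewrite (le_trans _ NT)// ler_nat leq_subr.
  have h1 := ler_wpM2r d0 NT.
  have h2 := ler_wpM2r k0 (ler_wpM2l K0 NmT).
  have e2 : 2 / (lambda * beta) * (lambda * T) * (kappa * lambda)
      = lambda * (2 * T / beta * kappa) by field; rewrite !gt_eqF.
  have e1 : lambda * lambda^-1 = 1 by rewrite mulfV ?gt_eqF.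
  rewrite {}e2 in h2; move: h1 h2; rewrite /D 3!(mulrDr lambda) e1.
  move: (2 * omega + _) (2 / (lambda * beta) * _ * _) (2 * T / beta * kappa).
  by move=> d e f; lra.
have E0 : 0 <= D + 2 / (lambda * beta) * (N - m)%:R * (kappa * lambda).
  by apply: addr_ge0 => //; apply: mulr_ge0 => //; apply: mulr_ge0.
move=> yE; rewrite -(ler_pM2l lambda0) -{1}(gtr0_norm lambda0) -normrM mulrBr.
rewrite mulrA mulfV ?gt_eqF// mul1r -/(y n) (le_trans yE)//.
rewrite [leRHS]mulrCA [leRHS]mulrC ler_pM//.
by rewrite exprn_ge0// addr_ge0.
Qed.

End good_paths.

(** * The fluid limit *)

Section tracking.
Context (R : realType) (h a0 : R) (u a b : R -> R).
Hypotheses (h0 : 0 < h) (alphaP : dde_init h a0 u).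
Hypothesis abP : fluid_solution h a0 u a b.

Lemma fluid_ratio_continuous T :
  {within `[h, T], continuous (fun t => a t / b t)}.
Proof.
have [ca cb] := fluid_continuous abP T (lexx h).
move/subspace_continuousP in ca; move/subspace_continuousP in cb.
apply/subspace_continuousP => t tT; apply: cvgM; first exact: ca.
apply: cvgV; last exact: cb.
move: tT; rewrite /= in_itv/= => /andP[ht _].
by have [_ /gt_eqF->] := fluid_gt0 h0 alphaP abP ht.
Qed.

(** Half of [delta] is spent on the motion of [a] between grid points. The other
    half is shared between the noise ([delta / 4]), the oscillation of [a / b]
    ([delta / 8]) and the errors of order [lambda ^ (-1/2)] ([delta / 8]), after
    amplification by [M]. The constant [M] is chosen before [delta]. *)
Lemma good_path_tracking T : 2 * h <= T ->
  exists2 M : R, 0 < M & forall delta, 0 < delta ->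
  exists lambda0 : R, forall (lambda : R) (m : nat),
    lambda0 <= lambda -> 0 < lambda -> lambda * h = m%:R ->
  forall v : m.-tuple 'I_3, F_init h a0 b lambda v ->
  let xi := xi_init lambda a0 in
  forall x : nat -> nat, (forall i : 'I_m, x i.+1 = tnth v i) ->
    ~ deviates m xi (delta / (4 * M) * lambda) (Num.truncn (lambda * T)) x ->
  forall t, h <= t <= T -> `|rescaledA lambda m xi x t - a t| <= delta.
Proof.
move=> hT; have h0' := h0; have hT' : h <= T by lra.
have T0 : 0 < T by lra.
have [beta beta0 b_lower] := fluid_b_lower h0 alphaP abP hT'.
pose M := expR (4 * T / beta); have M0 : 0 < M by exact: expR_gt0.
exists M => // delta d0.
pose c := Num.min h (a0 / 2).
have c0 : 0 < c by rewrite lt_min h0 divr_gt0//; case: alphaP.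
pose omega := delta / (16 * M * T).
have o0 : 0 < omega by rewrite divr_gt0// !mulr_gt0.
have d20 : 0 < delta / 2 by rewrite divr_gt0.
have cT : compact `[h, T] by exact: segment_compact.
have [ca _] := fluid_continuous abP T (lexx h).
have [r1 r10 r1P] := compact_uniform_continuity cT ca d20.
have [r2 r20 r2P] :=
  compact_uniform_continuity cT (@fluid_ratio_continuous T) o0.
(* [Q / sqrt lambda] will bound all the errors that vanish as [lambda] grows;
   [K] is the value of [sqrt lambda] from which it is below [delta / (8 M)]. *)
pose Q := 1 + T / c + 2 * T / beta * (4 * Num.sqrt h + 1).
have Q0 : 0 < Q.
  have : 0 < T / c by rewrite divr_gt0.
  suff : 0 <= 2 * T / beta * (4 * Num.sqrt h + 1) by rewrite /Q; lra.
  rewrite mulr_ge0// ?addr_ge0 ?mulr_ge0 ?sqrtr_ge0// ?invr_ge0 ltW//.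
pose K := 8 * M * Q / delta.
have K0 : 0 < K by rewrite divr_gt0// !mulr_gt0.
exists (1 + K ^+ 2 + r1^-1 + r2^-1) => lambda m lam l0 lh v vF xi x xv good.
move=> t /andP[ht tT].
have [r1V r2V] : 0 < r1^-1 /\ 0 < r2^-1 by rewrite !invr_gt0.
have K2 : 0 < K ^+ 2 by rewrite exprn_gt0.
have l1 : 1 <= lambda by lra.
have lK : K <= Num.sqrt lambda.
  by rewrite -ler_sqr ?nnegrE ?sqrtr_ge0 ?(ltW K0)// sqr_sqrtr ?(ltW l0)//; lra.
have lr1 : lambda^-1 <= r1.
  by rewrite -[leRHS]invrK lef_pV2 ?posrE//; lra.
have lr2 : lambda^-1 <= r2.
  by rewrite -[leRHS]invrK lef_pV2 ?posrE//; lra.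
have osc s s' : h <= s <= T -> h <= s' <= T -> `|s - s'| < lambda^-1 ->
    `|a s / b s - a s' / b s'| <= omega.
  move=> sT sT' ss; apply/ltW/r2P; rewrite /= ?in_itv//.
  exact: lt_le_trans lr2.
set n := Num.truncn (lambda * t).
have t0 : 0 < t by lra.
have lt0 : 0 <= lambda * t by rewrite ltW ?mulr_gt0.
have /andP[nt tn] : n%:R <= lambda * t < n.+1%:R by exact: truncn_itv.
have mn : (m <= n)%N by rewrite truncn_ge_nat// -lh ler_pM2l.
have nN : (n <= Num.truncn (lambda * T))%N.
  by apply: le_truncn; rewrite ler_pM2l.
have mnN : (m <= n <= Num.truncn (lambda * T))%N by rewrite mn.
have close := good_close h0 alphaP abP beta0 (ltW o0) b_lower osc l0 lh vF
  xv hT good mnN.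
pose s := lambda^-1 * n%:R.
have st : s <= t by rewrite /s mulrC ler_pdivrMr// mulrC.
have ts : t < s + lambda^-1.
  rewrite /s -[X in _ + X]mulr1 -mulrDr mulrC ltr_pdivlMr// mulrC.
  by rewrite natr1.
have hs : h <= s.
  by rewrite /s mulrC ler_pdivlMr// mulrC lh ler_nat.
have near_t : `|a s - a t| < delta / 2.
  apply: r1P; rewrite /= ?in_itv/= ?ht ?hs ?(le_trans st)//.
  by rewrite ltr_norml; lra.
rewrite /rescaledA -/n.
rewrite (_ : _ - _ = (lambda^-1 * (tangleX m xi x n)%:~R - a s) + (a s - a t));
  last by ring.
rewrite (le_trans (ler_normD _ _))//.
suff : `|lambda^-1 * (tangleX m xi x n)%:~R - a s| <= delta / 2 by lra.
apply: (le_trans close).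
set kappa := (X in 2 * T / beta * X).
have sl0 : 0 < Num.sqrt lambda by rewrite sqrtr_gt0.
have lV : lambda^-1 <= (Num.sqrt lambda)^-1.
  rewrite lef_pV2 ?posrE// -[leRHS](sqr_sqrtr (ltW l0)) expr2.
  by rewrite ler_peMl ?(ltW sl0)// -sqrtr1 ler_wsqrtr.
have errors : lambda^-1 + T * (c * lambda)^-1 + 2 * T / beta * kappa
    <= Q * (Num.sqrt lambda)^-1.
  have kV : kappa <= (4 * Num.sqrt h + 1) * (Num.sqrt lambda)^-1.
    by rewrite /kappa [leRHS]mulrDl mul1r lerD2l.
  have Tb0 : 0 <= 2 * T / beta by rewrite ltW// divr_gt0// mulr_gt0.
  have Tc0 : 0 <= T / c by rewrite ltW// divr_gt0.
  have -> : Q * (Num.sqrt lambda)^-1 = (Num.sqrt lambda)^-1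
      + T / c * (Num.sqrt lambda)^-1
      + 2 * T / beta * ((4 * Num.sqrt h + 1) * (Num.sqrt lambda)^-1).
    by rewrite /Q; ring.
  by rewrite (invfM c) mulrA !lerD// ler_wpM2l.
have errorsM : Q * (Num.sqrt lambda)^-1 <= delta / (8 * M).
  rewrite ler_pdivrMr// mulrC -ler_pdivrMr ?divr_gt0 ?mulr_gt0//.
  rewrite (le_trans _ lK)// le_eqVlt; apply/orP; left; apply/eqP.
  by rewrite /K; field; rewrite !gt_eqF.
rewrite -/M -/c.
rewrite (_ : delta / 2
  = M * (delta / (8 * M) + T * (2 * omega) + delta / (4 * M))); last first.
  by rewrite /omega; field; rewrite !gt_eqF.
rewrite ler_pM2l// mulrDr; lra.
Qed.

End tracking.

Lemma sup_dist_gt (R : realType) (D : set R) (f g : R -> R) (delta : R) :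
  (delta%:E < sup_dist D f g)%E -> ~ (forall t, D t -> `|f t - g t| <= delta).
Proof.
rewrite ltNge => /negP + le_delta; apply; apply: ge_ereal_sup => _ [t Dt <-].
by rewrite lee_fin le_delta.
Qed.

Lemma agree_rescaledA (R : realType) (lambda : R) m xi x y T :
    0 < lambda -> agree (Num.truncn (lambda * T)) x y ->
  forall t, t <= T -> rescaledA lambda m xi x t = rescaledA lambda m xi y t.
Proof.
move=> l0 xy t tT; rewrite /rescaledA (@agree_tangleX _ _ _ x y)//.
by apply: agree_le xy; apply: le_truncn; rewrite ler_pM2l.
Qed.

Lemma agree_rescaledB (R : realType) (lambda : R) m xi x y T :
    0 < lambda -> agree (Num.truncn (lambda * T)) x y ->
  forall t, t <= T -> rescaledB lambda m xi x t = rescaledB lambda m xi y t.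
Proof.
move=> l0 xy t tT; rewrite /rescaledB (@agree_tangleL _ _ _ x y)//.
by apply: agree_le xy; apply: le_truncn; rewrite ler_pM2l.
Qed.

Lemma eq_sup_dist (R : realType) (D : set R) (f f' g : R -> R) :
  (forall t, D t -> f t = f' t) -> sup_dist D f g = sup_dist D f' g.
Proof.
move=> ff; rewrite /sup_dist; congr ereal_sup; rewrite predeqE => r; split.
  by move=> [t Dt <-]; exists t; rewrite ?ff.
by move=> [t Dt <-]; exists t; rewrite ?ff.
Qed.

Lemma rescaledB_delay (R : realType) (h lambda : R) m xi x t :
    0 < lambda -> lambda * h = m%:R -> 0 < h -> 2 * h <= t ->
  rescaledB lambda m xi x t = rescaledA lambda m xi x (t - h) + h.
Proof.
move=> l0 lh h0 ht; have mt : m%:R <= lambda * (t - h).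
  by rewrite -lh ler_pM2l//; lra.
have tE : Num.truncn (lambda * t) = (Num.truncn (lambda * (t - h)) + m)%N.
  have /truncn_itv/andP[n1 n2] : 0 <= lambda * (t - h) by exact: le_trans mt.
  apply: truncn_def; rewrite -addSn !natrD -lh.
  by apply/andP; split; move: n1 n2; rewrite mulrBr; lra.
rewrite /rescaledB /rescaledA tE tangleL_delay.
  by rewrite rmorphD/= -pmulrn -lh mulrDr mulKf// gt_eqF.
by rewrite truncn_ge_nat// (le_trans _ mt).
Qed.

(** * Concentration of the tangle process *)

Unset Implicit Arguments.

Theorem theorem5 (R : realType) (h a0 : R) (u a b : R -> R) (hpos : 0 < h)
    (alphaP : dde_init h a0 u) (abP : fluid_solution h a0 u a b)
    (T : R) (hT : 2 * h <= T) :
  exists C : R, forall delta : R, 0 < delta ->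
  exists lambda0 : R, forall (lambda : R) (m : nat),
    lambda0 <= lambda -> 0 < lambda -> (0 < m)%N -> lambda * h = m%:R ->
  forall v : m.-tuple 'I_3, F_init h a0 b lambda v ->
  forall (d : measure_display) (Omega : measurableType d)
    (P : probability Omega R) (U : nat -> Omega -> nat),
    tangle_process P (xi_init lambda a0) v U ->
  let A w := rescaledA lambda m (xi_init lambda a0) (U ^~ w) in
  let B w := rescaledB lambda m (xi_init lambda a0) (U ^~ w) in
  let devA := [set w | (delta%:E < sup_dist `[h, T] (A w) a)%E] in
  let devB := [set w | (delta%:E < sup_dist `[(2 * h)%R, T] (B w) b)%E] in
  (P devB <= P devA)%E /\ (P devA <= (C * lambda^-1 * delta ^- 2)%:E)%E.
Proof.
have [M M0 tracking] := good_path_tracking hpos alphaP abP hT.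
exists (64 * T * M ^+ 2) => delta d0.
have [lambda0 {}tracking] := tracking delta d0.
exists lambda0 => lambda m lam l0 m0 lh v vF d Omega P U UP A B devA devB.
have {}tracking := tracking lambda m lam l0 lh v vF.
have [mU _ Uv _] := UP.
set N := Num.truncn (lambda * T).
have mdevA : measurable devA.
  apply: (measurable_finitary mU (N := N) (Q := fun x =>
    (delta%:E < sup_dist `[h, T] (rescaledA lambda m _ x) a)%E)) => x y xy.
  rewrite (@eq_sup_dist _ _ _ (rescaledA lambda m (xi_init lambda a0) y))//.
  by move=> t; rewrite /= in_itv/= => /andP[_]; apply: agree_rescaledA.
have mdevB : measurable devB.
  apply: (measurable_finitary mU (N := N) (Q := fun x =>
    (delta%:E < sup_dist `[(2 * h)%R, T] (rescaledB lambda m _ x) b)%E)).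
  move=> x y xy.
  rewrite (@eq_sup_dist _ _ _ (rescaledB lambda m (xi_init lambda a0) y))//.
  by move=> t; rewrite /= in_itv/= => /andP[_]; apply: agree_rescaledB.
split.
  (* The deviation of [B] at [t] is that of [A] at [t - h]. *)
  rewrite le_measure ?inE// => w; rewrite /devA /devB /= => /lt_le_trans; apply.
  apply: ge_ereal_sup => _ [t /= tT <-].
  move: tT; rewrite in_itv/= => /andP[ht tT].
  apply: ereal_sup_ubound; exists (t - h); first by rewrite /= in_itv/=; lra.
  rewrite /B /A (rescaledB_delay _ _ l0 lh hpos ht).
  have bE : b t = a (t - h) + h.
    by rewrite -(fluid_b_delay hpos alphaP abP) ?subrK//; lra.
  by rewrite bE; congr (`|_|%:E); ring.
set eta := delta / (4 * M) * lambda.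
have eta0 : 0 < eta by rewrite mulr_gt0// divr_gt0// mulr_gt0.
have mN : (m <= N)%N.
  by rewrite truncn_ge_nat -?lh ?ler_pM2l ?mulr_ge0//; lra.
have xi0 : (0 < xi_init lambda a0)%N by rewrite /xi_init leq_max orbT.
apply: (@le_trans _ _
  (P [set w | deviates m (xi_init lambda a0) eta N (U ^~ w)])).
  rewrite le_measure ?inE//.
    exact: (measurable_finitary mU (@agree_deviates _ m _ eta N)).
  move=> w /= /sup_dist_gt; apply: contra_notP => ndev t tT.
  by apply: (tracking (U ^~ w)) => //; move: tT; rewrite /= in_itv.
apply: (le_trans (prob_deviates_le UP eta0 xi0 mN)).
rewrite lee_fin.
have NT : (N - m)%:R <= lambda * T.
  rewrite (le_trans (_ : _ <= N%:R))// ?ler_nat ?leq_subr//.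
  by rewrite -truncn_ge_nat ?mulr_ge0//; lra.
have -> : 64 * T * M ^+ 2 * lambda^-1 * delta ^- 2
   = 4 * (lambda * T) / eta ^+ 2.
  by rewrite /eta; field; rewrite !gt_eqF.
by rewrite ler_pM2r ?invr_gt0 ?exprn_gt0// ler_pM2l.
Qed.
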